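(* For any $k\ge 2$, $$F_{\{L_4,[k]\}}(x)=1+x+x^2R_k(x)R_{k-1}(x)\bigl(R_{k-1}(x)+R_{k-2}(x)\bigr).$$
   Context: $\mathfrak{S}_n$ is the set of permutations of $\{1,\dots,n\}$ in one-line notation. A permutation $\pi\in\mathfrak{S}_n$ avoids a pattern $\tau\in\mathfrak{S}_k$ if no subsequence $(\pi_{i_1},\dots,\pi_{i_k})$ with $i_1<\dots<i_k$ is order-isomorphic to $\tau$. $L_4=\{1324,1423,1342,1432,3142,4132\}\subset\mathfrak{S}_4$, i.e. the set of all patterns in $\mathfrak{S}_4$ in which $1$ precedes $2$ with at least one entry strictly between them. $[k]$ denotes the identity pattern $(1,2,\dots,k)\in\mathfrak{S}_k$. $F_{\{L_4,[k]\}}(x)=\sum_{n\ge 0}a_nx^n$, where $a_n$ is the number of permutations in $\mathfrak{S}_n$ that avoid every pattern in $L_4$ and also avoid $[k]$. $U_r$ is the Chebyshev polynomial of the second kind, $U_r(\cos\theta)=\frac{\sin (r+1)\theta}{\sin\theta}$, equivalently $U_0(y)=1$, $U_1(y)=2y$, $U_r(y)=2yU_{r-1}(y)-U_{r-2}(y)$. For $k\ge 1$, $R_k(x)=\frac{2tU_{k-1}(t)}{U_k(t)}$ with $t=\frac{1}{2\sqrt x}$; this is a rational function of $x$ (e.g. $R_1(x)=1$, $R_2(x)=\frac{1}{1-x}$, $R_3(x)=\frac{1-x}{1-2x}$). By convention $R_0(x)=0$ (consistent with the same formula and $U_{-1}=0$). The identity is an identity of formal power series in $x$. *)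

(* Defs.v *)
From HB Require Import structures.
From mathcomp Require Import all_boot all_order all_fingroup all_algebra.

Set Implicit Arguments.
Unset Strict Implicit.
Unset Printing Implicit Defensive.

Import GRing.Theory.
Local Open Scope ring_scope.

(* Permutations of {1, ..., n} are elements of 'S_n, i.e. permutations of
   {0, ..., n.-1}; only [oneline] shifts the values back to {1, ..., n}. *)
Definition oneline (n : nat) (p : 'S_n) : seq nat :=
  [seq (val (p i)).+1 | i <- enum 'I_n].

Definition contains (n k : nat) (p : 'S_n) (tau : 'S_k) : bool :=
  [exists f : {ffun 'I_k -> 'I_n},
     [forall a : 'I_k, forall b : 'I_k,
        ((a < b)%N ==> (f a < f b)%N) &&
        ((p (f a) < p (f b))%N == (tau a < tau b)%N)]].

Definition avoids (n k : nat) (p : 'S_n) (tau : 'S_k) : bool :=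
  ~~ contains p tau.

Definition L4 : {set 'S_4} :=
  [set tau : 'S_4 | oneline tau \in
     [:: [:: 1; 3; 2; 4]; [:: 1; 4; 2; 3]; [:: 1; 3; 4; 2];
         [:: 1; 4; 3; 2]; [:: 3; 1; 4; 2]; [:: 4; 1; 3; 2] ]%N].

Definition idpat (k : nat) : 'S_k := 1%g.

(* A formal power series is given by its sequence of coefficients. *)
Definition F (k : nat) : nat -> rat := fun n =>
  #|[set p : 'S_n | [forall tau in L4, avoids p tau]
                    && avoids p (idpat k)]|%:R.

Fixpoint chebU (A : nzRingType) (r : nat) : {poly A} :=
  match r with
  | 0 => 1
  | r1.+1 => match r1 with
             | 0 => 2%:R *: 'X
             | r2.+1 => 2%:R *: 'X * chebU A r1 - chebU A r2
             end
  end.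

(* The field Q(sqrt x): its polynomial variable 'X is sqrt x. *)
Definition Qsx : fieldType := {fraction {poly rat}}.
Definition sqrtx : Qsx := tofrac ('X : {poly rat}).
Definition x : Qsx := sqrtx ^+ 2.
Definition t : Qsx := 1 / (2%:R * sqrtx).

Definition Rk (k : nat) : Qsx :=
  match k with
  | 0 => 0
  | k1.+1 => 2%:R * t * (chebU Qsx k1).[t] / (chebU Qsx k).[t]
  end.

(* [a] is the formal power series in x of the element [r] of Q(sqrt x):
   r = P(x) / Q(x) with P, Q polynomials, Q(0) <> 0, and the Cauchy product of
   Q and [a] is P; as Q(0) <> 0, such an [a] is unique for a given [r].
   P(x) is P \Po 'X^2 since 'X is sqrt x. *)
Definition has_power_series (r : Qsx) (a : nat -> rat) : Prop :=
  exists P Q : {poly rat},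
    [/\ Q`_0 != 0,
        r = tofrac (P \Po 'X^2) / tofrac (Q \Po 'X^2)
      & forall n : nat, \sum_(i < n.+1) Q`_i * a (n - i)%N = P`_n].

(* Main.v *)
(* A permutation of size n + 2 avoids L4 iff every occurrence a c b of 132, with
   a < b < c, has b and c the two largest values.  Its one-line word is then
   C u D v B with {u, v} the two largest values, C > D > B entrywise and C, D, B
   avoiding 132.  It avoids 12...k iff the longest
   increasing subsequences of (C, D, B) are shorter than (k-2, k-1, k) when
   u < v, and than (k-1, k-1, k) when u > v.  Splitting a 132-avoiding word at
   its maximum gives R_k = 1 / (1 - x R_{k-1}) for the series R_k of the words
   avoiding 132 and 12...k, which is the three-term recurrence of the U_r. *)
Require Import Defs.
From mathcomp Require Import all_boot all_order all_fingroup all_algebra zify ring.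

Set Implicit Arguments.
Unset Strict Implicit.
Unset Printing Implicit Defensive.

Local Open Scope nat_scope.

(** * Subsequences, occurrences of 132 and increasing subsequences of words *)

Lemma subseq_catE (T : eqType) (s w1 w2 : seq T) :
  subseq s (w1 ++ w2) ->
  exists s1 s2, [/\ s = s1 ++ s2, subseq s1 w1 & subseq s2 w2].
Proof.
case/subseqP=> m sz_m ->.
exists (mask (take (size w1) m) w1), (mask (drop (size w1) m) w2).
rewrite !mask_subseq -mask_cat ?cat_take_drop // size_takel // sz_m size_cat.
exact: leq_addr.
Qed.

(** Cutting [w] at an occurrence of [d] cuts [s] as well, and [d] fits in between. This serves to
    extend an occurrence of 132 to one of a pattern of length four. *)
Lemma subseq_insert (T : eqType) (d : T) (s w : seq T) :
  subseq s w -> d \in w -> d \notin s ->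
  exists s1 s2, s = s1 ++ s2 /\ subseq (s1 ++ d :: s2) w.
Proof.
move=> + /splitPr w12; case: w12 => w1 w2.
move=> /subseq_catE[s1 [s2 [-> s1w s2w]]]; rewrite mem_cat negb_or => /andP[_ ds2].
exists s1, s2; split=> //; apply: cat_subseq => //=; rewrite eqxx.
by case: s2 s2w ds2 => [|e s2] //=; rewrite ?sub0seq // in_cons eq_sym; case: eqP.
Qed.

(* Every 132-occurrence [a c b] has [b >= N]; plain 132-avoidance when [N]
   exceeds all the entries. *)
Definition avoids132_below (N : nat) (w : seq nat) : Prop :=
  forall a c b, subseq [:: a; c; b] w -> a < b < c -> N <= b.

Definition lis_lt (k : nat) (w : seq nat) : Prop :=
  forall s, subseq s w -> sorted ltn s -> size s < k.

Lemma avoids132_below_sub N w w' :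
  subseq w' w -> avoids132_below N w -> avoids132_below N w'.
Proof. by move=> sw avw a c b sub; apply: avw; apply: subseq_trans sw. Qed.

Lemma lis_lt_sub k w w' : subseq w' w -> lis_lt k w -> lis_lt k w'.
Proof. by move=> sw kw s sub; apply: kw; apply: subseq_trans sw. Qed.

Lemma lis_ltW k l w : k <= l -> lis_lt k w -> lis_lt l w.
Proof. by move=> kl kw s sub so; apply: leq_trans kl; apply: kw. Qed.

Lemma lis_lt0 w : ~ lis_lt 0 w.
Proof. by move/(_ [::] (sub0seq w) isT). Qed.

Lemma avoids132_below_bounded N M w :
  {in w, forall b, b < N} -> avoids132_below N w -> avoids132_below M w.
Proof.
move=> wN avw a c b sub abc; have := avw _ _ _ sub abc.
have/wN: b \in w by apply: (mem_subseq sub); rewrite !inE eqxx !orbT.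
by lia.
Qed.

(** An occurrence [a c b] with [b < N] cannot start or end at [u], since [N <= u]. If it has [u] in
    the middle or meets both sides, then [a] lies in [C] and [b] in [B], against the descent. Only
    letters of [B] below [N] are compared with [C], so [B] may hold a further large letter. *)
Lemma avoids132_below_cat N (C B : seq nat) u :
    N <= u -> {in C & B, forall c b, b < N -> b < c} ->
  avoids132_below N C -> avoids132_below N B ->
  avoids132_below N (C ++ u :: B).
Proof.
move=> Nu BC avC avB a c b /subseq_catE[s1 [s2 [E s1C s2B]]] abc.
case: (leqP N b) => // bN.
have bB : b \in B -> a \notin C.
  by move=> bB; apply/negP => aC; have := BC a b aC bB bN; lia.
case: s1 => [|a' s1] in E s1C.
  rewrite /= in E; move: s2B; rewrite -E [subseq _ _]/=.
  by case: eqP => [|_ /avB/(_ abc)]; lia.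
case: E => ? E; subst a'; have aC : a \in C by rewrite (mem_subseq s1C) ?mem_head.
case: s1 => [|c' s1] in E s1C.
  rewrite /= in E; move: s2B; rewrite -E [subseq _ _]/= => s2B.
  suff/bB: b \in B by rewrite aC.
  move: s2B; case: eqP => [_|_ /mem_subseq-> //]; first by rewrite sub1seq.
  by rewrite !inE eqxx orbT.
case: E => ? E; subst c'.
case: s1 => [|b' s1] in E s1C.
  rewrite /= in E; move: s2B; rewrite -E [subseq _ _]/=.
  by case: eqP => [|_]; [lia|rewrite sub1seq => /bB; rewrite aC].
case: E => ? E; subst b'.
by move: E s1C; case: s1 => //= _ /avC/(_ abc); lia.
Qed.

(** For [c < b] the word [c u b] would be an occurrence of 132 whose last letter is below [N];
    distinctness of the letters excludes [c = b]. *)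
Lemma avoids132_below_desc N (C B : seq nat) u :
    N <= u -> uniq (C ++ u :: B) -> avoids132_below N (C ++ u :: B) ->
  {in C & B, forall c b, b < N -> b < c}.
Proof.
move=> Nu Uw avw c b cC bB bN; case: (ltngtP b c) => // [cb|eqbc].
  have/avw: subseq [:: c; u; b] (C ++ u :: B).
    by rewrite -(cat1s c); apply: cat_subseq; rewrite ?sub1seq //= eqxx sub1seq.
  by lia.
move: Uw; rewrite cat_uniq => /and3P[_ /hasPn/(_ b) + _].
by rewrite in_cons bB orbT => /(_ isT); rewrite eqbc cC.
Qed.

(** An increasing subsequence through [u] ends there and otherwise lies in [C], which costs [C] one
    unit of length. *)
Lemma lis_lt_max k (C B : seq nat) u : {in C ++ B, forall c, c < u} ->
  lis_lt k.+1 (C ++ u :: B) <-> lis_lt k C /\ lis_lt k.+1 (C ++ B).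
Proof.
move=> ltu; split=> [kw|[kC kCB] s /subseq_catE[s1 [s2 [-> s1C s2B]]] so].
  split=> [s sC so|]; last first.
    by apply: lis_lt_sub kw; apply: cat_subseq => //; apply: subseq_cons.
  rewrite -ltnS -(size_rcons s u); apply: kw.
    by rewrite -cats1; apply: cat_subseq => //=; rewrite eqxx sub0seq.
  rewrite (sorted_pairwise ltn_trans) pairwise_rcons -(sorted_pairwise ltn_trans) so andbT.
  by apply/allP => c /(mem_subseq sC) cC; apply: ltu; rewrite mem_cat cC.
case: s2 => [|v s2] in s2B so *.
  apply: kCB => //; rewrite cats0; apply: subseq_trans s1C _.
  exact: prefix_subseq.
move: s2B => /=; case: eqP => [uv s2B|_ s2B]; last by apply: kCB => //; apply: cat_subseq.
case: s2 => [|v' s2] in s2B so *.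
  rewrite size_cat addn1 ltnS; apply: kC => //.
  by apply: (subseq_sorted ltn_trans _ so); apply: prefix_subseq.
have : v < v'.
  have : subseq [:: v; v'] (s1 ++ [:: v, v' & s2]).
    apply: subseq_trans (suffix_subseq s1 _).
    by rewrite -[X in subseq X](cats0) -[X in subseq _ X]/([:: v; v'] ++ s2); apply: prefix_subseq.
  by move/(subseq_sorted ltn_trans) => /(_ so) /=; rewrite andbT.
have: v' < u by apply: ltu; rewrite mem_cat (mem_subseq s2B) ?mem_head ?orbT.
by lia.
Qed.

(** No increasing subsequence meets both blocks. *)
Lemma lis_lt_desc k (C B : seq nat) : {in C & B, forall c b, b < c} ->
  lis_lt k (C ++ B) <-> lis_lt k C /\ lis_lt k B.
Proof.
move=> BC; split=> [kw|[kC kB] s /subseq_catE[s1 [s2 [-> s1C s2B]]] so].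
  split; apply: lis_lt_sub kw; [exact: prefix_subseq|exact: suffix_subseq].
case: s1 => [|c s1] in s1C so *; first exact: kB.
case: s2 => [|b s2] in s2B so *; first by rewrite cats0 in so *; apply: kC.
have cC : c \in C by rewrite (mem_subseq s1C) ?mem_head.
have bB : b \in B by rewrite (mem_subseq s2B) ?mem_head.
move: so; rewrite (sorted_pairwise ltn_trans) pairwise_cat => /andP[/allrelP/(_ c b)].
by rewrite !mem_head => /(_ isT isT); have := BC c b cC bB; lia.
Qed.

(** * Words on an interval of values *)

(** Sorting each block and putting [B] first gives a sorted arrangement of the interval, which is
    [iota m n] itself; comparing prefixes then gives the values of each block. *)
Lemma perm_iota_split m n (C B : seq nat) : {in C & B, forall c b, b < c} ->
  perm_eq (C ++ B) (iota m n) ->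
  [/\ n = size B + size C, perm_eq B (iota m (size B))
    & perm_eq C (iota (m + size B) (size C))].
Proof.
move=> BC PCB; have def_n : n = size B + size C.
  by rewrite -(size_iota m n) -(perm_size PCB) size_cat addnC.
suff: sort leq B ++ sort leq C = iota m (size B) ++ iota (m + size B) (size C).
  move/eqP; rewrite eqseq_cat ?size_sort ?size_iota // => /andP[/eqP EB /eqP EC].
  by split=> //; rewrite perm_sym -?EB -?EC perm_sort.
rewrite -iotaD -def_n; apply: (sorted_eq leq_trans anti_leq).
- rewrite (sorted_pairwise leq_trans) pairwise_cat -!(sorted_pairwise leq_trans).
  rewrite !(sort_sorted leq_total) !andbT; apply/allrelP => b c.
  by rewrite !mem_sort => bB cC; apply/ltnW/BC.
- exact: iota_sorted.
rewrite perm_catC; apply: perm_trans PCB.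
by apply: perm_cat; rewrite perm_sort.
Qed.

Lemma perm_iota_cat m n i (C B : seq nat) : i <= n ->
  perm_eq C (iota (m + i) (n - i)) -> perm_eq B (iota m i) ->
  perm_eq (C ++ B) (iota m n).
Proof.
move=> le_in PC PB; rewrite perm_catC -(subnKC le_in) iotaD.
exact: perm_cat.
Qed.

Lemma perm_iota_cat_max m n (C B : seq nat) :
  perm_eq (C ++ (m + n) :: B) (iota m n.+1) = perm_eq (C ++ B) (iota m n).
Proof.
rewrite -addn1 iotaD cats1 (permPr (permEl (perm_rcons _ _))).
by rewrite -cat1s perm_catCA perm_cons.
Qed.

(** * Gluing words around a marked letter, and the list of 132-avoiding words *)

Section Glue.

Variables (u n : nat) (X Y : nat -> seq (seq nat)).

(** In the uses below [i] counts the letters of [B], a second marked letter apart, and [C] has the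
    other [n - i]. *)
Definition glue : seq (seq nat) :=
  flatten [seq [seq C ++ u :: B | C <- X i, B <- Y i] | i <- iota 0 n.+1].

Lemma glueP w :
  reflect (exists i C B, [/\ i <= n, C \in X i, B \in Y i & w = C ++ u :: B])
          (w \in glue).
Proof.
apply: (iffP flatten_mapP) => [[i]|[i [C [B [le_in XC YB ->]]]]].
  rewrite mem_iota ltnS => le_in /allpairsP[[C B] [/= XC YB ->]].
  by exists i, C, B.
exists i; first by rewrite mem_iota ltnS.
by apply/allpairsP; exists (C, B).
Qed.

Lemma size_glue : size glue = \sum_(i < n.+1) size (X i) * size (Y i).
Proof.
rewrite size_flatten sumnE /shape -map_comp big_map.
rewrite -(big_mkord xpredT (fun i => size (X i) * size (Y i))).
by rewrite /index_iota subn0; apply: eq_bigr => i _ /=; rewrite size_allpairs.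
Qed.

Lemma cat_cons_inj (C B C' B' : seq nat) : u \notin C -> u \notin C' ->
  C ++ u :: B = C' ++ u :: B' -> C = C' /\ B = B'.
Proof.
move=> uC uC' E; have szC : size C = size C'.
  have := congr1 (index u) E; rewrite !index_cat (negPf uC) (negPf uC') /=.
  by rewrite eqxx !addn0.
by move/eqP: E; rewrite eqseq_cat //= eqseq_cons eqxx /= => /andP[/eqP-> /eqP->].
Qed.

(** The first [u] of a glued word marks the end of [C], as [C] does not contain [u], and the length
    of [C] determines [i]. *)
Lemma glue_uniq :
    (forall i, i <= n -> uniq (X i) /\ uniq (Y i)) ->
    (forall i C, i <= n -> C \in X i -> u \notin C /\ size C = n - i) ->
  uniq glue.
Proof.
move=> UXY XC; rewrite /glue.
pose Z i := [seq C ++ u :: B | C <- X i, B <- Y i].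
have -> : flatten [seq Z i | i <- iota 0 n.+1] = [seq w | i <- iota 0 n.+1, w <- Z i].
  by congr flatten; apply: eq_map => i; rewrite map_id.
apply: allpairs_uniq_dep; first exact: iota_uniq.
  move=> i; rewrite mem_iota ltnS => /= le_in; have [UX UY] := UXY i le_in.
  apply: allpairs_uniq => // -[C B] [C' B'] /allpairsP[[C1 B1] [/= XC1 _ [-> ->]]].
  move=> /allpairsP[[C2 B2] [/= XC2 _ [-> ->]]].
  have [uC1 _] := XC i C1 le_in XC1; have [uC2 _] := XC i C2 le_in XC2.
  by move/(cat_cons_inj uC1 uC2) => [-> ->].
move=> _ _ /allpairsPdep[i [w [+ Ziw ->]]] /allpairsPdep[i' [w' [+ Ziw' ->]]] /= Eww'.
rewrite !mem_iota !ltnS /= => le_in le_i'n; subst w'.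
case/allpairsP: Ziw => -[C B] [/= XC1 _ ->] in Ziw' *.
case/allpairsP: Ziw' => -[C' B'] [/= XC2 _].
have [uC1 sC1] := XC i C le_in XC1; have [uC2 sC2] := XC i' C' le_i'n XC2.
move/(cat_cons_inj uC1 uC2) => [EC _].
suff -> : i = i' by [].
by move: sC1 sC2; rewrite EC; lia.
Qed.

End Glue.

(* The words on [m, m + n) avoiding 132 and 12...k, split at their maximum;
   [d >= n] is fuel. *)
Fixpoint words132 (d m n k : nat) : seq (seq nat) :=
  match k, n, d with
  | 0, _, _ => [::]
  | _.+1, 0, _ => [:: [::]]
  | _.+1, _.+1, 0 => [::]
  | k'.+1, n'.+1, d'.+1 =>
      glue (m + n') n' (fun i => words132 d' (m + i) (n' - i) k')
                       (fun i => words132 d' m i k)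
  end.

Lemma words132P d m n k w : n <= d ->
  reflect [/\ perm_eq w (iota m n), avoids132_below (m + n) w & lis_lt k w]
          (w \in words132 d m n k).
Proof.
elim: d m n k w => [|d IHd] m [|n] [|k] w //= le_nd; try by constructor => -[_ _ /lis_lt0].
1,2: by rewrite inE; apply: (iffP eqP) => [->|[/perm_nilP]] //;
  split=> // s; rewrite subseq0 => /eqP->.
rewrite -[m :: _]/(iota m n.+1).
apply: (iffP (glueP _ _ _ _ _)) => [[i [C [B [le_in]]]]|[Pw avw kw]].
  case/IHd=> [|PC avC kC]; first lia.
  case/IHd=> [|PB avB kB ->]; first lia.
  have ltC c : c \in C -> m + i <= c < m + n.
    by rewrite (perm_mem PC) mem_iota; lia.
  have ltB b : b \in B -> m <= b < m + i by rewrite (perm_mem PB) mem_iota; lia.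
  have ltBC : {in C & B, forall c b, b < c} by move=> c b /ltC + /ltB; lia.
  have P : perm_eq (C ++ B) (iota m n) by apply: perm_iota_cat PC PB.
  split; first by rewrite perm_iota_cat_max.
    apply: (@avoids132_below_bounded (m + n).+1).
      move=> b; rewrite mem_cat in_cons => /or3P[/ltC|/eqP|/ltB]; lia.
    have: avoids132_below (m + n) (C ++ (m + n) :: B).
      apply: avoids132_below_cat => //.
      - by move=> c b /ltBC + /[dup] bB => /(_ _ bB).
      - by apply: avoids132_below_bounded avC => b /ltC; lia.
      - by apply: avoids132_below_bounded avB => b /ltB; lia.
    (* An occurrence now has [b >= m + n], hence [c > m + n], beyond every letter. *)
    move=> av a c b sub abc; have := av a c b sub abc.
    have: c \in C ++ (m + n) :: B.
      by rewrite (mem_subseq sub) // !inE eqxx orbT.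
    by rewrite mem_cat in_cons => /or3P[/ltC|/eqP|/ltB]; lia.
  apply/lis_lt_max.
    by move=> c; rewrite mem_cat => /orP[/ltC|/ltB]; lia.
  by split=> //; apply/lis_lt_desc => //; split=> //; apply: lis_ltW kC.
have [C [B def_w]] : exists C B : seq nat, w = C ++ (m + n) :: B.
  have : m + n \in w by rewrite (perm_mem Pw) mem_iota; lia.
  by case/splitPr=> C B; exists C, B.
rewrite {}def_w in Pw avw kw *.
have ltw c : c \in C ++ B -> m <= c < m + n.
  by rewrite perm_iota_cat_max in Pw; rewrite (perm_mem Pw) mem_iota.
have U : uniq (C ++ (m + n) :: B) by rewrite (perm_uniq Pw) iota_uniq.
(* Avoidance of 132 across the maximum forces this descent, which fixes the values of [C] and [B]
   once their sizes are known. *)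
have ltBC : {in C & B, forall c b, b < c}.
  move=> c b cC bB; apply: (avoids132_below_desc (N := m + n) _ U) => //.
    by move=> a c' b' s1 s2; have := avw _ _ _ s1 s2; lia.
  by have := ltw b; rewrite mem_cat bB orbT; lia.
rewrite perm_iota_cat_max in Pw.
have [def_n PB PC] := perm_iota_split ltBC Pw.
move: kw => /lis_lt_max[|kC /(lis_lt_desc _ ltBC)[_ kB]].
  by move=> c /ltw; lia.
have szC : n - size B = size C by lia.
exists (size B), C, B; split=> //; first by lia.
  apply/IHd; first lia; rewrite szC; split=> //.
  apply: (@avoids132_below_bounded (m + n.+1)).
    by move=> c cC; have := ltw c; rewrite mem_cat cC; lia.
  by apply: avoids132_below_sub avw; apply: prefix_subseq.
apply/IHd; first lia; split=> //.
apply: (@avoids132_below_bounded (m + n.+1)).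
  by move=> c cC; have := ltw c; rewrite mem_cat cC orbT; lia.
apply: avoids132_below_sub avw; rewrite -cat_rcons; exact: suffix_subseq.
Qed.

Lemma words132_uniq d m n k : n <= d -> uniq (words132 d m n k).
Proof.
elim: d m n k => [|d IHd] m [|n] [|k] //= le_nd.
apply: glue_uniq => [i le_in|i C le_in /words132P[|P _ _]]; last 2 first.
- lia.
- by rewrite (perm_size P) size_iota (perm_mem P) mem_iota; split=> //; lia.
by split; apply: IHd; lia.
Qed.

(** * Splitting at the two largest values *)

(** The cut points [i <= j] give [B] the values below [i], [D] those from [i] to [j - 1] and [C]
    those from [j] to [n - 1]. With [u] and [v] abstract, both orders of the two largest values are
    treated at once. *)
Definition split_top2 (u v n kC kD kB : nat) : seq (seq nat) :=
  glue u n (fun j => words132 n j (n - j) kC)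
    (fun j => glue v j (fun i => words132 n i (j - i) kD)
                       (fun i => words132 n 0 i kB)).

Section SplitTop2.

Variables (u v n : nat).
Hypothesis uv_top : perm_eq [:: u; v] [:: n; n.+1].

Let u_ge : n <= u.
Proof. by have := perm_mem uv_top u; rewrite !inE eqxx; lia. Qed.

Let v_ge : n <= v.
Proof. by have := perm_mem uv_top v; rewrite !inE eqxx; lia. Qed.

Lemma perm_split_top2 (C D B : seq nat) :
  perm_eq (C ++ u :: D ++ v :: B) (iota 0 n.+2) =
  perm_eq (C ++ D ++ B) (iota 0 n).
Proof.
have -> : perm_eq (C ++ u :: D ++ v :: B) (iota 0 n.+2)
    = perm_eq ([:: n; n.+1] ++ C ++ D ++ B) (iota 0 n.+2).
  apply: permPl; rewrite perm_sym.
  apply: perm_trans (_ : perm_eq ([:: u; v] ++ C ++ D ++ B) _).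
    by rewrite perm_cat2r perm_sym.
  by apply/seq.permP => a; rewrite !count_cat /= !count_cat /=; lia.
by rewrite -addn2 iotaD perm_sym perm_catC perm_sym perm_cat2l.
Qed.

(** Both [u] and [v] are at least [n], so an ascent across either of them would complete an
    occurrence of 132 ending below [n]. *)
Lemma split_top2_desc (C D B : seq nat) :
    perm_eq (C ++ u :: D ++ v :: B) (iota 0 n.+2) ->
    avoids132_below n (C ++ u :: D ++ v :: B) ->
  [/\ {in C ++ D ++ B, forall c, c < n},
      {in C & D ++ B, forall c b, b < c} & {in D & B, forall d b, b < d}].
Proof.
move=> P av; have U := perm_uniq P; rewrite iota_uniq in U.
have ltn w : w \in C ++ D ++ B -> w < n.
  by rewrite perm_split_top2 in P; rewrite (perm_mem P) mem_iota.
split=> // [c b cC bDB|d b dD bB].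
  apply: (avoids132_below_desc u_ge U av) => //.
    by move: bDB; rewrite !mem_cat in_cons => /orP[]->; rewrite ?orbT.
  by apply: ltn; rewrite mem_cat bDB orbT.
have sub : subseq (D ++ v :: B) (C ++ u :: D ++ v :: B).
  by rewrite -(cat_rcons u) suffix_subseq.
apply: (avoids132_below_desc v_ge (subseq_uniq sub U)) => //.
  exact: avoids132_below_sub av.
by apply: ltn; rewrite !mem_cat bB !orbT.
Qed.

Lemma split_top2P kC kD kB w :
  w \in split_top2 u v n kC kD kB <->
  exists C D B : seq nat, [/\ w = C ++ u :: D ++ v :: B,
    perm_eq w (iota 0 n.+2), avoids132_below n w
    & [/\ lis_lt kC C, lis_lt kD D & lis_lt kB B]].
Proof.
split=> [/glueP[j [C [_ [le_jn + /glueP[i [D [B [le_ij + + ->]]]] ->]]]]|].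
  move=> /words132P[|PC avC kC']; first lia.
  move=> /words132P[|PD avD kD']; first lia.
  move=> /words132P[|PB avB kB']; first lia.
  have ltC c : c \in C -> j <= c < n by rewrite (perm_mem PC) mem_iota; lia.
  have ltD c : c \in D -> i <= c < j by rewrite (perm_mem PD) mem_iota; lia.
  have ltB c : c \in B -> c < i by rewrite (perm_mem PB) mem_iota; lia.
  exists C, D, B; split=> //.
    rewrite perm_split_top2; apply: (@perm_iota_cat 0 n j _ _ le_jn PC).
    exact: (@perm_iota_cat 0 j i _ _ le_ij PD PB).
  apply: avoids132_below_cat => //.
  - move=> c b /ltC cC; rewrite mem_cat in_cons => /or3P[/ltD|/eqP|/ltB]; lia.
  - by apply: avoids132_below_bounded avC => c /ltC; lia.
  apply: avoids132_below_cat => //.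
  - by move=> c b /ltD + /ltB; lia.
  - by apply: avoids132_below_bounded avD => c /ltD; lia.
  - by apply: avoids132_below_bounded avB => c /ltB; lia.
case=> C [D [B [-> P av [kC' kD' kB']]]].
have [lt_n descC descD] := split_top2_desc P av.
move: P; rewrite perm_split_top2 => P.
have [def_n PDB PC] := perm_iota_split descC P.
have [def_j PB PD] := perm_iota_split descD PDB.
rewrite add0n in PC PD.
have szC : n - size (D ++ B) = size C by lia.
have szD : size (D ++ B) - size B = size D by lia.
(* All letters of the blocks are below [n], so for them the bound [n] means plain avoidance of 132
   and any bound may replace it. *)
have avn X : subseq X (C ++ u :: D ++ v :: B) ->
    {subset X <= C ++ D ++ B} -> forall N, avoids132_below N X.
  move=> subX memX N; apply: (@avoids132_below_bounded n).
    by move=> x /memX /lt_n.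
  exact: avoids132_below_sub av.
apply/glueP; exists (size (D ++ B)), C, (D ++ v :: B); split=> //; first lia.
  apply/words132P; rewrite szC; first lia; split=> //.
  apply: avn; first exact: prefix_subseq.
  by move=> x xC; rewrite mem_cat xC.
apply/glueP; exists (size B), D, B; split=> //; first lia.
  apply/words132P; rewrite szD; first lia; split=> //.
  apply: avn; last by move=> x xC; rewrite !mem_cat xC orbT.
  rewrite -(cat_rcons u).
  exact: subseq_trans (prefix_subseq D _) (suffix_subseq _ _).
apply/words132P; [lia|split=> //].
apply: avn; last by move=> x xC; rewrite !mem_cat xC !orbT.
by rewrite -(cat_rcons u) -(cat_rcons v) catA suffix_subseq.
Qed.

Lemma split_top2_uniq kC kD kB : uniq (split_top2 u v n kC kD kB).
Proof.
apply: glue_uniq => [j le_jn|j C le_jn /words132P[|P _ _]]; last 2 first.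
- lia.
- by rewrite (perm_size P) size_iota (perm_mem P) mem_iota; split=> //; lia.
split; first by apply: words132_uniq; lia.
apply: glue_uniq => [i le_ij|i D le_ij /words132P[|P _ _]]; last 2 first.
- lia.
- by rewrite (perm_size P) size_iota (perm_mem P) mem_iota; split=> //; lia.
by split; apply: words132_uniq; lia.
Qed.

End SplitTop2.

(** Here [k] and [n] are the pattern length and the permutation size, each minus two. In the first
    list an increasing subsequence of [C] can be prolonged by [n] and then [n.+1], one of [D] by
    [n.+1] only. In the second, one of [C] can be prolonged by either but not both, and one of [D]
    by [n] only. *)
Definition avoiders (k n : nat) : seq (seq nat) :=
  split_top2 n n.+1 n k k.+1 k.+2 ++ split_top2 n.+1 n n k.+1 k.+1 k.+2.

(** The maximum [n.+1] is removed first; then [n] is the maximum both of the part before it and of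
    the whole remainder. What is left descends block by block. *)
Lemma lis_lt_top2_incr k n (C D B : seq nat) :
    {in C ++ D ++ B, forall c, c < n} -> {in C & D ++ B, forall c b, b < c} ->
    {in D & B, forall d b, b < d} ->
  lis_lt k.+2 (C ++ n :: D ++ n.+1 :: B) <->
  [/\ lis_lt k C, lis_lt k.+1 D & lis_lt k.+2 B].
Proof.
move=> lt_n descC descD.
have ltC c : c \in C -> c < n by move=> cC; apply: lt_n; rewrite mem_cat cC.
have ltD c : c \in D -> c < n by move=> cD; apply: lt_n; rewrite !mem_cat cD orbT.
have ltB c : c \in B -> c < n by move=> cB; apply: lt_n; rewrite !mem_cat cB !orbT.
have descCD : {in C & D, forall c b, b < c}.
  by move=> c d cC dD; apply: descC => //; rewrite mem_cat dD.
have descCDB : {in C ++ D & B, forall c b, b < c}.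
  move=> c b; rewrite mem_cat => /orP[cC bB|]; last exact: descD.
  by apply: descC => //; rewrite mem_cat bB orbT.
have max1 : {in C ++ D, forall c, c < n}.
  by move=> c; rewrite mem_cat => /orP[/ltC|/ltD].
have max2 : {in (C ++ n :: D) ++ B, forall c, c < n.+1}.
  move=> c; rewrite !mem_cat in_cons => /orP[/or3P[/ltC|/eqP|/ltD]|/ltB]; lia.
rewrite -cat_cons catA; split.
  case/(lis_lt_max _ max2) => /(lis_lt_max _ max1)[kC /(lis_lt_desc _ descCD)[_ kD]] kCDB.
  by split=> //; apply: lis_lt_sub kCDB; apply: suffix_subseq.
case=> kC kD kB; apply/(lis_lt_max _ max2).
have kCD : lis_lt k.+1 (C ++ n :: D).
  apply/(lis_lt_max _ max1); split=> //; apply/(lis_lt_desc _ descCD).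
  by split=> //; apply: lis_ltW kC.
(* Without [n.+1] the bound is still [k.+2], so [C] and [D] have room to spare. *)
split=> //; rewrite -catA cat_cons.
have max3 : {in C ++ D ++ B, forall c, c < n} by [].
apply/(lis_lt_max _ max3); split; first by apply: lis_ltW kC.
rewrite catA; apply/(lis_lt_desc _ descCDB); split=> //.
by apply/(lis_lt_desc _ descCD); split; [apply: lis_ltW kC|apply: lis_ltW kD]; lia.
Qed.

(** Removing [n.+1] bounds [C], and removing [n] bounds [C] and [D]; no increasing subsequence uses
    both large letters. *)
Lemma lis_lt_top2_decr k n (C D B : seq nat) :
    {in C ++ D ++ B, forall c, c < n} -> {in C & D ++ B, forall c b, b < c} ->
    {in D & B, forall d b, b < d} ->
  lis_lt k.+2 (C ++ n.+1 :: D ++ n :: B) <->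
  [/\ lis_lt k.+1 C, lis_lt k.+1 D & lis_lt k.+2 B].
Proof.
move=> lt_n descC descD.
have descCD : {in C & D, forall c b, b < c}.
  by move=> c d cC dD; apply: descC => //; rewrite mem_cat dD.
have max1 : {in (C ++ D) ++ B, forall c, c < n} by rewrite -catA.
have max2 : {in C ++ D ++ n :: B, forall c, c < n.+1}.
  move=> c; have := lt_n c; rewrite !mem_cat in_cons.
  case: (c \in C) => //= [/(_ isT)|]; first by lia.
  case: (c \in D) => //= [/(_ isT)|]; first by lia.
  case: (c \in B) => //= [/(_ isT)|]; first by lia.
  by move=> _ /orP[/eqP|]; lia.
split.
  case/(lis_lt_max _ max2) => kC; rewrite catA.
  case/(lis_lt_max _ max1) => /(lis_lt_desc _ descCD)[_ kD] kCDB.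
  by split=> //; apply: lis_lt_sub kCDB; apply: suffix_subseq.
case=> kC kD kB; apply/(lis_lt_max _ max2); split=> //; rewrite catA.
apply/(lis_lt_max _ max1); split; first exact/(lis_lt_desc _ descCD).
rewrite -catA; apply/(lis_lt_desc _ descC); split; first by apply: lis_ltW kC.
by apply/(lis_lt_desc _ descD); split=> //; apply: lis_ltW kD.
Qed.

Lemma perm_top2_incr n : perm_eq [:: n; n.+1] [:: n; n.+1].
Proof. by []. Qed.

Lemma perm_top2_decr n : perm_eq [:: n.+1; n] [:: n; n.+1].
Proof. by apply/seq.permP => a /=; lia. Qed.

Lemma avoidersP k n w :
  w \in avoiders k n <->
  [/\ perm_eq w (iota 0 n.+2), avoids132_below n w & lis_lt k.+2 w].
Proof.
have top1 := perm_top2_incr n; have top2 := perm_top2_decr n.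
rewrite mem_cat; split=> [/orP[]|[P av kw]].
- case/(split_top2P top1) => C [D [B [-> P av kCDB]]].
  have [lt_n descC descD] := split_top2_desc top1 P av; split=> //.
  exact/lis_lt_top2_incr.
- case/(split_top2P top2) => C [D [B [-> P av kCDB]]].
  have [lt_n descC descD] := split_top2_desc top2 P av; split=> //.
  exact/lis_lt_top2_decr.
have [C [E def_w]] : exists C E : seq nat, w = C ++ n :: E.
  have : n \in w by rewrite (perm_mem P) mem_iota; lia.
  by case/splitPr=> C E; exists C, E.
have : n.+1 \in w by rewrite (perm_mem P) mem_iota; lia.
(* The side of [n] on which [n.+1] lies selects the list. *)
rewrite def_w mem_cat in_cons => /or3P[wC|/eqP|wE]; first 1 [idtac|lia|idtac].
  have [C1 [D def_C]] : exists C1 D : seq nat, C = C1 ++ n.+1 :: D.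
    by case/splitPr: wC => C1 D; exists C1, D.
  move: def_w; rewrite {}def_C -catA cat_cons => def_w; rewrite {}def_w in P av kw *.
  have [lt_n descC descD] := split_top2_desc top2 P av.
  apply/orP; right; apply/(split_top2P top2); exists C1, D, E; split=> //.
  exact/(lis_lt_top2_decr _ lt_n descC descD).
have [D [B def_E]] : exists D B : seq nat, E = D ++ n.+1 :: B.
  by case/splitPr: wE => D B; exists D, B.
rewrite {}def_E in def_w *; rewrite {}def_w in P av kw *.
have [lt_n descC descD] := split_top2_desc top1 P av.
apply/orP; left; apply/(split_top2P top1); exists C, D, B; split=> //.
exact/(lis_lt_top2_incr _ lt_n descC descD).
Qed.

(** The two lists are disjoint because they differ in which of [n] and [n.+1] comes first. *)
Lemma avoiders_uniq k n : uniq (avoiders k n).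
Proof.
have top1 := perm_top2_incr n; have top2 := perm_top2_decr n.
rewrite cat_uniq !split_top2_uniq // andbT /=.
apply/hasPn => w /(split_top2P top2)[C [D [B [-> P _ _]]]].
apply/negP => /(split_top2P top1)[C' [D' [B' [E _ _ _]]]].
have U : uniq (C ++ n.+1 :: D ++ n :: B) by rewrite (perm_uniq P) iota_uniq.
have U' : uniq (C' ++ n :: D' ++ n.+1 :: B') by rewrite -E.
have idx (X Y Z : seq nat) a b : uniq (X ++ a :: Y ++ b :: Z) ->
    index a (X ++ a :: Y ++ b :: Z) < index b (X ++ a :: Y ++ b :: Z).
  rewrite cat_uniq /= mem_cat !negb_or => /and4P[_ /andP[aX bYX] /and3P[_ ab _] _].
  rewrite !index_cat (negPf aX) /= eqxx addn0 (negPf ab).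
  case: ifP => [bX|_]; last by lia.
  by case/hasP: bYX; exists b; rewrite // mem_cat mem_head orbT.
by have := idx _ _ _ _ _ U; rewrite E; have := idx _ _ _ _ _ U'; lia.
Qed.

(** * From permutations to words *)

(** Values start at 0, unlike in [oneline], so that a word is an arrangement of [iota 0 n]. *)
Definition word (n : nat) (p : 'S_n) : seq nat := [seq val (p i) | i <- enum 'I_n].

Lemma size_word n (p : 'S_n) : size (word p) = n.
Proof. by rewrite size_map size_enum_ord. Qed.

Lemma nth_word n (p : 'S_n) (i : 'I_n) : nth 0 (word p) i = p i.
Proof. by rewrite (nth_map i) ?size_enum_ord // nth_ord_enum. Qed.

Lemma word_uniq n (p : 'S_n) : uniq (word p).
Proof. by rewrite map_inj_uniq ?enum_uniq // => i j /val_inj/perm_inj. Qed.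

Lemma perm_word n (p : 'S_n) : perm_eq (word p) (iota 0 n).
Proof.
apply: uniq_perm; rewrite ?word_uniq ?iota_uniq // => c; rewrite mem_iota /=.
apply/mapP/idP => [[i _ ->]|lt_cn]; first exact: ltn_ord.
exists ((p^-1)%g (Ordinal lt_cn)); first by rewrite mem_enum.
by rewrite permKV.
Qed.

Lemma word_inj n : injective (@word n).
Proof.
by move=> p q E; apply/permP => i; apply: val_inj; rewrite /= -!nth_word E.
Qed.

Lemma word_surj n w : perm_eq w (iota 0 n) -> exists p : 'S_n, word p = w.
Proof.
move=> P; have sz_w : size w = n by rewrite (perm_size P) size_iota.
have Uw : uniq w by rewrite (perm_uniq P) iota_uniq.
have lt_w (i : 'I_n) : nth 0 w i < n.
  have: nth 0 w i \in w by rewrite mem_nth ?sz_w.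
  by rewrite (perm_mem P) mem_iota.
have inj_w : injective (fun i => Ordinal (lt_w i)).
  move=> i j /(congr1 val) /= /eqP; rewrite nth_uniq ?sz_w // => /eqP.
  exact: val_inj.
exists (perm inj_w); apply: (@eq_from_nth _ 0); rewrite ?size_word ?sz_w // => i lt_in.
by rewrite (nth_word _ (Ordinal lt_in)) permE.
Qed.

Lemma card_word n (A : {set 'S_n}) (L : seq (seq nat)) : uniq L ->
    (forall w, w \in L -> perm_eq w (iota 0 n)) ->
    (forall p, (p \in A) = (word p \in L)) ->
  #|A| = size L.
Proof.
move=> UL PL AL; rewrite cardE -(size_map (@word n)); apply: perm_size.
apply: uniq_perm => //; first by rewrite (map_inj_uniq (@word_inj n)) enum_uniq.
move=> w; apply/mapP/idP => [[p + ->]|wL]; first by rewrite mem_enum AL.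
have [p def_w] := word_surj (PL w wL); exists p => //.
by rewrite mem_enum AL def_w.
Qed.

(** An embedding [f] lists increasing positions, whose values form a subsequence; conversely, the
    mask of a subsequence selects its positions in [enum 'I_n]. *)
Lemma contains_word n k (p : 'S_n) (tau : 'S_k) :
  reflect (exists2 s : seq nat, subseq s (word p) & size s = k /\
             forall a b : 'I_k, (nth 0 s a < nth 0 s b) = (tau a < tau b))
          (contains p tau).
Proof.
apply: (iffP existsP) => [[f /forallP f_ok]|[s /subseqP[m sz_m ->] [sz_s ord_s]]].
  have f_mono (a b : 'I_k) : a < b -> f a < f b.
    by move=> ab; move/forallP: (f_ok a) => /(_ b) /andP[/implyP-> //].
  exists [seq val (p i) | i <- [seq f a | a <- enum 'I_k]].
    apply: map_subseq.
    (* Both sides are strictly increasing lists with the same elements. *)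
    suff -> : [seq f a | a <- enum 'I_k] = [seq i <- enum 'I_n | i \in codom f].
      exact: filter_subseq.
    have ltT : transitive (fun i j : 'I_n => i < j) by move=> i j l; apply: ltn_trans.
    have ord_sorted m : sorted (fun i j : 'I_m => i < j) (enum 'I_m).
      by have := iota_ltn_sorted 0 m; rewrite -val_enum_ord sorted_map.
    apply: (irr_sorted_eq ltT) => [i|||i]; first by rewrite /= ltnn.
    - exact: homo_sorted f_mono _ (ord_sorted k).
    - exact: (sorted_filter ltT).
    rewrite mem_filter mem_enum andbT; apply/mapP/codomP => [[a _ ->]|[a ->]];
      by exists a; rewrite ?mem_enum.
  rewrite 2!size_map size_enum_ord; split=> // a b.
  have nthE (c : 'I_k) :
      nth 0 [seq val (p i) | i <- [seq f a | a <- enum 'I_k]] c = p (f c).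
    by rewrite -map_comp (nth_map c) ?size_enum_ord // nth_ord_enum.
  by rewrite !nthE; move/forallP: (f_ok a) => /(_ b) /andP[_ /eqP].
rewrite -map_mask in sz_s ord_s *; set e := mask m (enum 'I_n) in sz_s ord_s *.
rewrite size_map in sz_s.
have e_sorted : sorted ltn (map val e).
  rewrite /e map_mask val_enum_ord; apply: (subseq_sorted ltn_trans (mask_subseq _ _)).
  exact: iota_ltn_sorted.
exists [ffun a : 'I_k => tnth (Tuple (introT eqP sz_s)) a].
apply/forallP => a; apply/forallP => b; rewrite !ffunE.
pose i0 := tnth (Tuple (introT eqP sz_s)) a.
rewrite !(tnth_nth i0) /= -ord_s !(nth_map i0) ?sz_s // eqxx andbT.
apply/implyP => ab; rewrite -!(nth_map i0 0 val) ?sz_s //.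
by apply: (sorted_ltn_nth ltn_trans) => //; rewrite inE size_map sz_s.
Qed.

Lemma avoids_idpat n k (p : 'S_n) : avoids p (idpat k) <-> lis_lt k (word p).
Proof.
split=> [/contains_word av s s_p so|kp].
  (* An increasing subsequence that is too long is cut to its first [k] terms. *)
  rewrite ltnNge; apply/negP => le_ks; apply: av; exists (take k s).
    exact: subseq_trans (take_subseq _ _) s_p.
  rewrite size_takel //; split=> // a b; rewrite !nth_take // !perm1.
  have mono (c d : 'I_k) : c < d -> nth 0 s c < nth 0 s d.
    by apply: (sorted_ltn_nth ltn_trans) => //; rewrite inE;
       apply: leq_trans (ltn_ord _) le_ks.
  case: (ltngtP a b) => [/mono //|/mono|/val_inj ->]; last by rewrite ltnn.
  by lia.
apply/contains_word => -[s s_p [sz_s ord_s]].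
suff : size s < k by rewrite sz_s ltnn.
apply: kp => //; apply/(sortedP 0) => i; rewrite sz_s => lt_ik.
have lt_i : i < k by lia.
by have := ord_s (Ordinal lt_i) (Ordinal lt_ik); rewrite !perm1 /= => ->.
Qed.

Lemma nth_oneline n (p : 'S_n) (i : 'I_n) : nth 0 (oneline p) i = (p i).+1.
Proof. by rewrite (nth_map i) ?size_enum_ord // nth_ord_enum. Qed.

(** The permutation [tau] sends each position to the rank of its entry, that is, the number of
    smaller entries. The second conjunct lets membership in [L4] be decided by computing ranks. *)
Lemma standardize k (s : seq nat) : uniq s -> size s = k ->
  exists tau : 'S_k,
    (forall a b : 'I_k, (nth 0 s a < nth 0 s b) = (tau a < tau b)) /\
    oneline tau = [seq (count (gtn c) s).+1 | c <- s].
Proof.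
move=> Us sz_s.
pose r c := count (gtn c) s.
have r_mono c d : c \in s -> c < d -> r c < r d.
  (* The entries below [c] are among those below [d], and [c] itself is counted only for [d]. *)
  move=> cs cd; rewrite /r.
  rewrite -(size_filter (gtn c)) -(size_filter (gtn d)).
  have -> : [seq b <- s | gtn c b] = [seq b <- [seq b <- s | gtn d b] | gtn c b].
    by rewrite -filter_predI; apply: eq_filter => b /=; lia.
  rewrite size_filter -(count_predC (gtn c)) -addn1 leq_add2l -has_count.
  by apply/hasP; exists c; rewrite ?mem_filter /= ?cd // ltnn.
have r_lt c : c \in s -> r c < k.
  move=> cs; rewrite -sz_s -(count_predC (gtn c)) -addn1 leq_add2l -has_count.
  by apply/hasP; exists c; rewrite //= ltnn.
have r_ord c d : c \in s -> d \in s -> (c < d) = (r c < r d).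
  move=> cs ds; case: (ltngtP c d) => [/(r_mono _ _ cs)->//|/(r_mono _ _ ds)|->].
    by lia.
  by rewrite ltnn.
have mem_s (a : 'I_k) : nth 0 s a \in s by rewrite mem_nth ?sz_s.
have inj_r : injective (fun a : 'I_k => Ordinal (r_lt _ (mem_s a))).
  move=> a b /(congr1 val) /= E; apply/val_inj/eqP.
  rewrite -(@nth_uniq _ 0 s a b) ?sz_s //.
  have r_ab : (nth 0 s a < nth 0 s b) = false by rewrite r_ord // E ltnn.
  have r_ba : (nth 0 s b < nth 0 s a) = false by rewrite r_ord // E ltnn.
  by case: ltngtP r_ab r_ba.
exists (perm inj_r); split=> [a b|]; first by rewrite !permE /= -r_ord.
rewrite /oneline; apply: (@eq_from_nth _ 0) => [|i].
  by rewrite [LHS]size_map [RHS]size_map size_enum_ord.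
rewrite size_map size_enum_ord => lt_ik.
rewrite (nth_map (Ordinal lt_ik)) ?size_enum_ord // (nth_map 0) ?sz_s //.
by rewrite -[i in nth _ _ i]/(val (Ordinal lt_ik)) nth_ord_enum permE.
Qed.

(** A pattern of [L4] is an occurrence of 132 on its 1, a larger entry and its 2, together with one
    more entry above the 2. Such an extra entry exists exactly when [b] is below the two largest
    values [n] and [n.+1]. *)
Lemma avoids_L4 n (p : 'S_n.+2) :
  [forall tau in L4, avoids p tau] <-> avoids132_below n (word p).
Proof.
have lt_p (c : nat) : c \in word p -> c < n.+2 by rewrite (perm_mem (perm_word p)) mem_iota.
split=> [/forall_inP av a c b sub abc|av].
  case: (leqP n b) => // lt_bn.
  (* Both [n] and [n.+1] exceed [b], and at most one of them is [c]. *)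
  have [d [dp bd dc]] : exists d, [/\ d \in word p, b < d & d != c].
    exists (if c == n then n.+1 else n); rewrite (perm_mem (perm_word p)) mem_iota.
    by case: eqP => ?; split=> //; lia.
  have dacb : d \notin [:: a; c; b] by rewrite !inE; lia.
  have no_sub s : subseq s (word p) -> size s = 4 ->
      [seq (count (gtn e) s).+1 | e <- s] \in
        [:: [:: 1; 3; 2; 4]; [:: 1; 4; 2; 3]; [:: 1; 3; 4; 2];
            [:: 1; 4; 3; 2]; [:: 3; 1; 4; 2]; [:: 4; 1; 3; 2] ] -> False.
    move=> s_p sz_s; have Us := subseq_uniq s_p (word_uniq p).
    have [tau [ord_tau <-]] := standardize Us sz_s => tauL.
    have tauL4 : tau \in L4 by rewrite inE.
    have /contains_word := av tau tauL4; apply.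
    by exists s.
  have ins : [\/ subseq [:: d; a; c; b] (word p), subseq [:: a; d; c; b] (word p),
                 subseq [:: a; c; d; b] (word p) | subseq [:: a; c; b; d] (word p)].
    have [s1 [s2 [E]]] := subseq_insert sub dp dacb.
    case: s1 E => [|a' [|c' [|b' [|e s1]]]] //=.
    - by move=> <- ?; constructor.
    - by case=> <- <- ?; constructor.
    - by case=> <- <- <- ?; constructor.
    - by case=> <- <- <- <- ?; constructor.
  have gtE e f : e < f -> ((f < e) = false) * ((e < f) = true).
    by move=> ef; split=> //; lia.
  have [ab bc] : a < b /\ b < c by lia.
  have [ac ad] : a < c /\ a < d by lia.
  (* These are all the comparisons except that of [c] with [d]; once it is decided, the ranks
     compute. *)
  have H := (gtE _ _ ab, gtE _ _ bc, gtE _ _ ac, gtE _ _ ad, gtE _ _ bd, ltnn).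
  exfalso; have [cd|cd] : c < d \/ d < c by lia.
    by case: ins => sub4; apply: (no_sub _ sub4 erefl); rewrite /= !H !(gtE _ _ cd).
  by case: ins => sub4; apply: (no_sub _ sub4 erefl); rewrite /= !H !(gtE _ _ cd).
apply/forall_inP => tau; rewrite inE => tauL; apply/contains_word => -[s s_p [sz_s ord_s]].
case: s sz_s => [|y0 [|y1 [|y2 [|y3 [|//]]]]] // _ in s_p ord_s.
have y_p (c : nat) : c \in [:: y0; y1; y2; y3] -> c < n.+2 by move/(mem_subseq s_p)/lt_p.
have ord_y (a b : 'I_4) : (nth 0 [:: y0; y1; y2; y3] a < nth 0 [:: y0; y1; y2; y3] b)
    = (nth 0 (oneline tau) a < nth 0 (oneline tau) b).
  by rewrite ord_s !nth_oneline ltnS.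
pose i0 : 'I_4 := @Ordinal 4 0 isT; pose i1 : 'I_4 := @Ordinal 4 1 isT.
pose i2 : 'I_4 := @Ordinal 4 2 isT; pose i3 : 'I_4 := @Ordinal 4 3 isT.
have avm (m : bitseq) (a c b : nat) : mask m [:: y0; y1; y2; y3] = [:: a; c; b] ->
    a < b < c -> n <= b.
  by move=> m_acb; apply: av; apply: subseq_trans s_p; rewrite -m_acb mask_subseq.
(* In each pattern the 1, a larger entry and the 2 stand at positions 0 1 2, 0 1 3 or 1 2 3. The
   entry playing 2 has two distinct larger entries below [n.+2], so it is below [n]. *)
have := avm [:: true; true; true] _ _ _ erefl.
have := avm [:: true; true; false; true] _ _ _ erefl.
have := avm [:: false; true; true; true] _ _ _ erefl.
move: (ord_y i0 i1) (ord_y i0 i2) (ord_y i0 i3) (ord_y i1 i2) (ord_y i1 i3) (ord_y i2 i3).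
move: (ord_y i1 i0) (ord_y i2 i0) (ord_y i3 i0) (ord_y i2 i1) (ord_y i3 i1) (ord_y i3 i2).
have [[[lt0 lt1] lt2] lt3] := (y_p y0, y_p y1, y_p y2, y_p y3).
rewrite !inE !eqxx !orbT /= in lt0 lt1 lt2 lt3; move: (lt0 isT) (lt1 isT) (lt2 isT) (lt3 isT).
move: tauL; rewrite !inE => /or4P[/eqP->|/eqP->|/eqP->|/or3P[]/eqP->] /=; lia.
Qed.

(** * Counting words *)

Definition count132 (k n : nat) : nat := size (words132 n 0 n k).

(** The offset [m] only translates the values, and any sufficient fuel gives the same list. *)
Lemma size_words132 d m n k : n <= d -> size (words132 d m n k) = count132 k n.
Proof.
(* The induction is strong because the two sides unfold with different amounts of fuel. *)
rewrite /count132; elim/ltn_ind: d m n k => -[|d] IHd m [|n] [|k] // le_nd.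
rewrite /= !size_glue; apply: eq_bigr => i _; have lt_in := ltn_ord i.
by congr (_ * _); do 2!(rewrite IHd; try lia).
Qed.

Lemma count132_rec k n :
  count132 k.+1 n.+1 = \sum_(i < n.+1) count132 k (n - i) * count132 k.+1 i.
Proof.
rewrite {1}/count132 /= size_glue; apply: eq_bigr => i _; have lt_in := ltn_ord i.
by rewrite !size_words132; lia.
Qed.

Lemma size_split_top2 u v n kC kD kB :
  size (split_top2 u v n kC kD kB) = \sum_(j < n.+1) count132 kC (n - j) *
    \sum_(i < j.+1) count132 kD (j - i) * count132 kB i.
Proof.
rewrite size_glue; apply: eq_bigr => j _; have lt_jn := ltn_ord j.
rewrite size_words132 ?size_glue; last by lia.
congr (_ * _); apply: eq_bigr => i _; have lt_ij := ltn_ord i.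
by rewrite !size_words132; lia.
Qed.

Lemma F_small k n : n <= 1 -> F k.+2 n = 1%:R%R.
Proof.
move=> le_n1; rewrite /F; have -> : [set p : 'S_n | [forall tau in L4, avoids p tau]
    && avoids p (idpat k.+2)] = setT.
  apply/setP => p; rewrite !inE.
  (* A pattern of length at least two needs two distinct positions. *)
  have av l (tau : 'S_l.+2) : avoids p tau.
    apply/existsP => -[f /forallP/(_ ord0)/forallP/(_ ord_max)/andP[/implyP/(_ isT) lt_f _]].
    by have := leq_trans (leq_ltn_trans lt_f (ltn_ord _)) le_n1.
  by rewrite av andbT; apply/forall_inP => tau _; apply: av.
rewrite cardsT card_Sn; congr (_%:R)%R.
by move: le_n1; case: n => [|[|]].
Qed.

Lemma F_top2 k n : F k.+2 n.+2 = ((size (avoiders k n))%:R)%R.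
Proof.
congr (_%:R)%R; apply: card_word; first exact: avoiders_uniq.
  by move=> w /avoidersP[].
move=> p; rewrite inE; apply/andP/idP => [[/avoids_L4 avp /avoids_idpat kp]|].
  by apply/avoidersP; split=> //; apply: perm_word.
by case/avoidersP => _ /avoids_L4 avp /avoids_idpat kp.
Qed.

(** * Formal power series through truncated polynomials *)

Local Open Scope ring_scope.
Import GRing.Theory.

Definition cauchy (a b : nat -> rat) (n : nat) : rat :=
  \sum_(i < n.+1) a (n - i)%N * b i.

Definition shift (a : nat -> rat) (n : nat) : rat :=
  if n is n'.+1 then a n' else 0.

(** Truncations, compared up to degree [N], let identities between series be computed in the ring of
    polynomials. *)
Definition trunc (N : nat) (a : nat -> rat) : {poly rat} := \poly_(i < N.+1) a i.

Definition eq_upto (N : nat) (p q : {poly rat}) : Prop :=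
  forall n, (n <= N)%N -> p`_n = q`_n.

Lemma eq_upto_mul N p p' q q' :
  eq_upto N p p' -> eq_upto N q q' -> eq_upto N (p * q) (p' * q').
Proof.
move=> Ep Eq n le_nN; rewrite !coefM; apply: eq_bigr => i _.
have lt_in := ltn_ord i; by rewrite Ep ?Eq //; lia.
Qed.

Lemma eq_upto_trans N p q r : eq_upto N p q -> eq_upto N q r -> eq_upto N p r.
Proof. by move=> Epq Eqr n le_nN; rewrite Epq ?Eqr. Qed.

Lemma coef_trunc N a n : (n <= N)%N -> (trunc N a)`_n = a n.
Proof. by move=> le_nN; rewrite coef_poly ltnS le_nN. Qed.

Lemma trunc_cauchy N a b :
  eq_upto N (trunc N (cauchy a b)) (trunc N a * trunc N b).
Proof.
move=> n le_nN; rewrite coef_trunc // coefMr; apply: eq_bigr => i _.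
have lt_in := ltn_ord i; by rewrite !coef_trunc //; lia.
Qed.

Lemma trunc_shift N a : eq_upto N (trunc N (shift a)) ('X * trunc N a).
Proof.
move=> [|n] le_nN; rewrite coef_trunc // coefXM //=.
by rewrite coef_trunc //; lia.
Qed.

Lemma trunc_mulP (P Q : {poly rat}) (a : nat -> rat) :
  (forall n, \sum_(i < n.+1) Q`_i * a (n - i)%N = P`_n) <->
  (forall N, eq_upto N (Q * trunc N a) P).
Proof.
have E N n : (n <= N)%N -> (Q * trunc N a)`_n = \sum_(i < n.+1) Q`_i * a (n - i)%N.
  move=> le_nN; rewrite coefM; apply: eq_bigr => i _.
  by rewrite coef_trunc //; lia.
by split=> [H N n le_nN|H n]; rewrite ?E // -?H // -(E n) // H.
Qed.

Definition fracx (P : {poly rat}) : Qsx := tofrac (P \Po 'X^2).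

Lemma fracxD P Q : fracx (P + Q) = fracx P + fracx Q.
Proof. by rewrite /fracx !rmorphD. Qed.

Lemma fracxB P Q : fracx (P - Q) = fracx P - fracx Q.
Proof. by rewrite /fracx [in LHS]rmorphB; exact: rmorphB. Qed.

Lemma fracxM P Q : fracx (P * Q) = fracx P * fracx Q.
Proof. by rewrite /fracx !rmorphM. Qed.

Lemma fracx1 : fracx 1 = 1.
Proof. by rewrite /fracx !rmorph1. Qed.

Lemma fracxX : fracx 'X = x.
Proof. by rewrite /fracx comp_polyX rmorphXn. Qed.

Lemma fracx_neq0 (Q : {poly rat}) : Q`_0 != 0 -> fracx Q != 0.
Proof.
apply: contraNneq => /eqP; rewrite tofrac_eq0 => /eqP Q0.
have := congr1 (fun p : {poly rat} => p.[0]) Q0.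
by rewrite /= horner_comp hornerXn expr0n horner0 horner_coef0 => ->.
Qed.

Lemma has_power_seriesP r a :
  has_power_series r a <-> exists P Q : {poly rat},
    [/\ Q`_0 != 0, r = fracx P / fracx Q & forall N, eq_upto N (Q * trunc N a) P].
Proof.
by split=> -[P [Q [Q0 -> /trunc_mulP Qa]]]; exists P, Q.
Qed.

Lemma eq_power_series r a b :
  a =1 b -> has_power_series r a -> has_power_series r b.
Proof.
move=> ab [P [Q [Q0 -> Qa]]]; exists P, Q; split=> // n.
by rewrite -Qa; apply: eq_bigr => i _; rewrite ab.
Qed.

Lemma power_series1 : has_power_series 1 (fun n => (n == 0%N)%:R).
Proof.
apply/has_power_seriesP; exists 1, 1; rewrite fracx1 divr1 coef1; split=> // N n le_nN.
by rewrite mul1r coef_trunc // coef1.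
Qed.

Lemma power_series0 : has_power_series 0 (fun=> 0).
Proof.
apply/has_power_seriesP; exists 0, 1; rewrite /fracx !rmorph0 mul0r coef1.
by split=> // N n le_nN; rewrite mul1r coef_trunc // coef0.
Qed.

Lemma power_seriesD r s a b :
  has_power_series r a -> has_power_series s b ->
  has_power_series (r + s) (fun n => a n + b n).
Proof.
move=> /has_power_seriesP[P [Q [Q0 -> Qa]]] /has_power_seriesP[P' [Q' [Q'0 -> Qb]]].
apply/has_power_seriesP; exists (P * Q' + P' * Q), (Q * Q'); split.
- by rewrite coefM big_ord1 mulf_neq0.
- by rewrite addf_div ?fracx_neq0 // fracxD !fracxM.
move=> N n le_nN.
have -> : trunc N (fun n => a n + b n) = trunc N a + trunc N b.
  by apply/polyP => m; rewrite coefD !coef_poly; case: ifP; rewrite ?addr0.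
rewrite mulrDr !coefD mulrAC; congr (_ + _).
  exact: (eq_upto_mul (Qa N) (fun _ _ => erefl)).
rewrite -mulrA [Q * _]mulrC.
exact: (eq_upto_mul (Qb N) (fun _ _ => erefl)).
Qed.

Lemma power_seriesM r s a b :
  has_power_series r a -> has_power_series s b ->
  has_power_series (r * s) (cauchy a b).
Proof.
move=> /has_power_seriesP[P [Q [Q0 -> Qa]]] /has_power_seriesP[P' [Q' [Q'0 -> Qb]]].
apply/has_power_seriesP; exists (P * P'), (Q * Q'); split.
- by rewrite coefM big_ord1 mulf_neq0.
- by rewrite mulf_div !fracxM.
move=> N; apply: eq_upto_trans (_ : eq_upto N _ (Q * Q' * (trunc N a * trunc N b))) _.
  exact: (eq_upto_mul (fun _ _ => erefl) (trunc_cauchy a b)).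
by rewrite mulrACA; apply: eq_upto_mul.
Qed.

Lemma power_series_xM r a :
  has_power_series r a -> has_power_series (x * r) (shift a).
Proof.
move=> /has_power_seriesP[P [Q [Q0 -> Qa]]].
apply/has_power_seriesP; exists ('X * P), Q; split=> //.
  by rewrite fracxM fracxX mulrA.
move=> N; apply: eq_upto_trans (_ : eq_upto N _ (Q * ('X * trunc N a))) _.
  exact: (eq_upto_mul (fun _ _ => erefl) (@trunc_shift N a)).
by rewrite mulrCA; apply: eq_upto_mul.
Qed.

Lemma one_sub_mul_div (K : fieldType) (c p q : K) :
  q != 0 -> 1 - c * (p / q) = (q - c * p) / q.
Proof. by move=> q0; rewrite mulrBl divff // mulrA. Qed.

(** For [r = P / Q] the numerator [Q - x P] has the constant coefficient of [Q], which is
    nonzero. *)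
Lemma power_series_geom_neq0 r a : has_power_series r a -> 1 - x * r != 0.
Proof.
move=> /has_power_seriesP[P [Q [Q0 -> _]]]; have Q'0 := fracx_neq0 Q0.
rewrite (one_sub_mul_div _ _ Q'0); apply: mulf_neq0; last exact: invr_neq0.
by rewrite -fracxX -fracxM -fracxB; apply: fracx_neq0; rewrite coefB coefXM subr0.
Qed.

(** The recurrence says [b = 1 + x a b] as series, so [b] is the inverse of [1 - x a]; for
    [r = P / Q] this is [Q / (Q - x P)]. *)
Lemma power_series_geom r a b : has_power_series r a ->
    b 0%N = 1 -> (forall n, b n.+1 = cauchy a b n) ->
  has_power_series (1 - x * r)^-1 b.
Proof.
move=> /has_power_seriesP[P [Q [Q0 -> Qa]]] b0 bS; have Q'0 := fracx_neq0 Q0.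
apply/has_power_seriesP; exists Q, (Q - 'X * P); split.
- by rewrite coefB coefXM subr0.
- by rewrite (one_sub_mul_div _ _ Q'0) invf_div fracxB fracxM fracxX.
move=> N n le_nN.
(* This is [b - x a b = 1] up to degree [N]; multiplying it by [Q] turns [Q a] into [P]. *)
have Eb : eq_upto N (trunc N b - 'X * (trunc N a * trunc N b)) 1.
  move=> m le_mN; rewrite coefB coef_trunc // coefXM coef1.
  case: m le_mN => [|m] le_mN /=; first by rewrite b0 subr0.
  rewrite bS -trunc_cauchy; last by lia.
  by rewrite coef_trunc ?subrr //; lia.
have := eq_upto_mul (fun _ _ => erefl) Eb le_nN => /(_ Q); rewrite mulr1 => <-.
rewrite mulrBl mulrBr !coefB; congr (_ - _).
rewrite mulrCA -mulrA !coefXM; case: n le_nN => // n le_nN /=; rewrite mulrA.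
by apply/esym/(eq_upto_mul (Qa N)) => //; lia.
Qed.

(** * Chebyshev quotients as generating functions *)

Definition gf132 (k n : nat) : rat := (count132 k n)%:R.

Lemma two_t : 2%:R * t = sqrtx^-1.
Proof.
rewrite /t mul1r invfM mulrA divff ?mul1r //.
have -> : (2%:R : Qsx) = tofrac (2%:R%:P : {poly rat}) by rewrite !rmorph_nat.
by rewrite tofrac_eq0 polyC_eq0.
Qed.

Lemma sqrtx_neq0 : sqrtx != 0.
Proof. by rewrite tofrac_eq0 polyX_eq0. Qed.

(** With [2 c = 1 / s] the three-term recurrence factors as [U_{k+1} = s^-1 U_k (1 - s^2 r)], which
    gives both the nonvanishing and the quotient. Here [s] and [c] stand for [sqrtx] and [t]. *)
Lemma chebU_ratioS (K : fieldType) (c s r : K) (k : nat) :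
    s != 0 -> 2%:R * c = s^-1 -> (chebU K k).[c] != 0 ->
    r = (if k is k'.+1 then 2%:R * c * (chebU K k').[c] / (chebU K k).[c] else 0) ->
    1 - s ^+ 2 * r != 0 ->
  (chebU K k.+1).[c] != 0 /\
  2%:R * c * (chebU K k).[c] / (chebU K k.+1).[c] = (1 - s ^+ 2 * r)^-1.
Proof.
move=> s0 cs Uk0 def_r r0; rewrite cs in def_r *.
suff -> : (chebU K k.+1).[c] = s^-1 * (chebU K k).[c] * (1 - s ^+ 2 * r).
  have sU0 : s^-1 * (chebU K k).[c] != 0 by rewrite mulf_neq0 ?invr_neq0.
  by split; [rewrite mulf_neq0|rewrite invfM mulrA divff ?mul1r].
rewrite {}def_r {r0}; case: k Uk0 => [|k] Uk0.
  by rewrite /= hornerZ hornerX hornerC mulr0 subr0 !mulr1 cs.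
have -> : (chebU K k.+2).[c] = 2%:R * c * (chebU K k.+1).[c] - (chebU K k).[c].
  by rewrite [chebU K k.+2]/= hornerD hornerN hornerM hornerZ hornerX.
rewrite cs; move: (chebU K k.+1).[c] (chebU K k).[c] Uk0 => u v u0.
by field; rewrite s0 u0.
Qed.

(** The nonvanishing of [U_k] is carried along the induction, since the next quotient divides by
    it. *)
Lemma Rk_power_series k : (chebU Qsx k).[t] != 0 /\ has_power_series (Rk k) (gf132 k).
Proof.
elim: k => [|k [Uk0 IHk]].
  split; first by rewrite hornerC oner_eq0.
  (* No word has all its increasing subsequences shorter than 0, so the counts vanish, in accordance
     with [Rk 0 = 0]. *)
  by apply: eq_power_series power_series0 => -[].
have def_Rk : Rk k = if k is k'.+1 then 2%:R * t * (chebU Qsx k').[t] / (chebU Qsx k).[t] else 0.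
  by case: k {Uk0 IHk}.
have [Uk1 R_rec] := chebU_ratioS sqrtx_neq0 two_t Uk0 def_Rk (power_series_geom_neq0 IHk).
split; first exact: Uk1.
rewrite [Rk k.+1]R_rec; apply: (power_series_geom IHk).
  by [].
move=> n; rewrite /gf132 count132_rec natr_sum; apply: eq_bigr => i _.
exact: natrM.
Qed.

Theorem theorem5p17 (k : nat) (hk : (2 <= k)%N) :
  has_power_series
    (1 + x + x ^+ 2 * Rk k * Rk (k - 1) * (Rk (k - 1) + Rk (k - 2)))
    (F k).
Proof.
case: k hk => [//|[//|k]] _.
rewrite !subSS !subn0.
have [_ R0] := Rk_power_series k; have [_ R1] := Rk_power_series k.+1.
have [_ R2] := Rk_power_series k.+2.
have R12 := power_seriesM R1 R2.
(* The two summands are the two orders of the largest values; their factors are the series of [C],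
   [D] and [B]. *)
have S := power_seriesD (power_seriesM R0 R12) (power_seriesM R1 R12).
(* The two factors [x] account for the two largest values. *)
have {}S := power_series_xM (power_series_xM S).
have T := power_seriesD (power_seriesD power_series1 (power_series_xM power_series1)) S.
have -> : 1 + x + x ^+ 2 * Rk k.+2 * Rk k.+1 * (Rk k.+1 + Rk k) =
  1 + x * 1 + x * (x * (Rk k * (Rk k.+1 * Rk k.+2) + Rk k.+1 * (Rk k.+1 * Rk k.+2))).
  generalize (Rk k) (Rk k.+1) (Rk k.+2) x => r0 r1 r2 y; ring.
apply: eq_power_series T => -[|[|n]].
- by rewrite F_small.
- by rewrite F_small.
(* From degree two on, the terms [1] and [x] contribute nothing. *)
rewrite F_top2 size_cat !size_split_top2 natrD !natr_sum /= !add0r.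
by congr (_ + _); apply: eq_bigr => j _; rewrite natrM natr_sum; congr (_ * _);
  apply: eq_bigr => i _; rewrite natrM.
Qed.
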